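(* Let $p$ be a prime with $p\equiv 3\pmod 4$, let $e$ be an odd positive integer, and let $q=p^e$. Let the integers $b_k$ ($1\le k\le q^2-q+1$), read in $\mathbb{F}_q$, be the coefficients defined in the context. Then the following identities hold in $\mathbb{F}_q$. Case 1: $q=3$. \[ \sum_{x\in\mathbb{F}_q} f_j(x)= \begin{cases} 0 & \text{if } 1\le j\le q-1,\\ -b_{j-(q-1)} & \text{if } q\le j\le q+1,\\ -b_{j+2} & \text{if } j=q^2-(q+1),\\ 0 & \text{if } q^2-q\le j\le q^2-1. \end{cases} \] Case 2: $q>3$. \[ \sum_{x\in\mathbb{F}_q} f_j(x)= \begin{cases} 0 & \text{if } 1\le j\le q-1,\\ -b_{j-(q-1)} & \text{if } q\le j\le q+1,\\ -b_{j-(q-1)}-\displaystyle\sum_{x\in\mathbb{F}_q} f_{j-(q+1)}(x) & \text{if } q+2\le j\le q^2-(q+2),\\ -b_{j+2} & \text{if } j=q^2-(q+1),\\ 0 & \text{if } q^2-q\le j\le q^2-1. \end{cases} \]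
   Context: The Fibonacci polynomials are defined by $f_0(x)=0$, $f_1(x)=1$, and $f_n(x)=xf_{n-1}(x)+f_{n-2}(x)$ for $n\ge 2$; they are evaluated at elements of the finite field $\mathbb{F}_q$ with $q$ elements. The coefficients $b_k$ are defined by the polynomial identity $\sum_{k=1}^{q^2-q+1} b_k z^k = z\,\bigl(1+(z-z^q)^{q-1}\bigr)$ over $\mathbb{F}_q$. Explicitly, writing $k=\alpha+\beta q$ with $0\le\alpha,\beta\le q-1$: $b_k=(-1)^\beta\binom{q-1}{\beta}$ if $\alpha+\beta=q$; $b_k=1$ if $\alpha+\beta=1$; and $b_k=0$ otherwise. *)

(* Defs.v *)
From mathcomp Require Import all_boot all_order all_algebra.
Set Implicit Arguments.
Unset Strict Implicit.
Unset Printing Implicit Defensive.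
Import GRing.Theory.
Local Open Scope ring_scope.

Fixpoint fib_poly (R : nzRingType) (n : nat) : {poly R} :=
  match n with
  | 0 => 0
  | 1 => 1
  | (m.+1 as m').+1 => 'X * fib_poly R m' + fib_poly R m
  end.

(* For q > 1, b_poly R q has degree at most q ^ 2 - q + 1 and no constant term,
   so its coefficients satisfy the defining identity of the b_k: see b_coefE. *)
Definition b_poly (R : nzRingType) (q : nat) : {poly R} :=
  'X * (1 + ('X - 'X^q) ^+ (q - 1)).

Definition b_coef (R : nzRingType) (q k : nat) : R := (b_poly R q)`_k.

Lemma b_coefE (R : nzRingType) (q : nat) (q_gt1 : (1 < q)%N) :
  \sum_(1 <= k < (q ^ 2 - q + 1).+1) b_coef R q k *: 'X^k = b_poly R q.
Proof.
have szX : (size ('X - 'X^q : {poly R})%R <= q.+1)%N.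
  apply: leq_trans (size_polyD _ _) _.
  by rewrite size_polyN size_polyX size_polyXn geq_max leqnn andbT ltnS ltnW.
have Eq : (q * (q - 1) = q ^ 2 - q)%N by rewrite mulnBr muln1 -mulnn.
have sz1 : (size (1 + ('X - 'X^q : {poly R}) ^+ (q - 1))%R <= (q ^ 2 - q).+1)%N.
  apply: leq_trans (size_polyD _ _) _; rewrite size_poly1 geq_max /=.
  apply: leq_trans (size_poly_exp_leq _ _) _.
  by rewrite ltnS -Eq leq_mul2r -subn1 leq_subLR add1n szX orbT.
have sz : (size (b_poly R q) <= (q ^ 2 - q + 1).+1)%N.
  apply: leq_trans (size_polyMleq _ _) _.
  by rewrite size_polyX /= addn1 ltnS.
apply/polyP => i; rewrite coef_sum.
under eq_bigr do rewrite coefZ coefXn.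
have [i_lt|i_ge] := ltnP i (q ^ 2 - q + 1).+1; last first.
  rewrite nth_default ?(leq_trans sz) // big_nat big1 // => k /andP[_ kl].
  by rewrite gtn_eqF ?mulr0 // (leq_trans kl).
case: i i_lt => [_|i i_lt].
  rewrite [RHS]coefXM big_nat big1 // => k /andP[k_gt0 _].
  by rewrite ltn_eqF ?mulr0.
rewrite (bigD1_seq i.+1) ?mem_index_iota ?iota_uniq //= eqxx mulr1.
by rewrite big1 ?addr0 // => k /negPf; rewrite eq_sym => ->; rewrite mulr0.
Qed.

(* Main.v *)
(* Over F_q the characteristic polynomial m = X^2 - x X - 1 of the recurrence
   satisfies m^q = X^(2q) - x X^q - 1 since x^q = x, so m divides
   m^q - X^(q-1) m = (X^(q-1) - 1) (X^(q+1) + 1).  Hence S_j = sum_x f_j(x),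
   extended to negative j by the recurrence, is annihilated by
   (E^(q-1) - 1) (E^(q+1) + 1), E being the shift.  The values S_j with |j| <= q
   are power sums: S_q = S_(-q) = -1 and the others vanish.  As
   sum_k b_k z^k = z (1 - z^(q^2-1)) / (1 - z^(q-1)), the sequences
   S_j + S_(j-q-1) and - b_(j-q+1) agree on the range of the b's.  When
   q = 3 mod 4, (E^(q-1) - 1) (E^(q+1) + 1) divides E^(q^2-1) - 1, so S has
   period q^2 - 1, which reduces the top range of j to -q <= j <= 0. *)
Require Import Defs.
From mathcomp Require Import all_boot all_order all_algebra.
From mathcomp Require Import all_fingroup all_solvable all_field zify ring.
Set Implicit Arguments.
Unset Strict Implicit.
Unset Printing Implicit Defensive.
Import GRing.Theory.
Local Open Scope ring_scope.

(** * Degree and leading coefficient of Fibonacci polynomials *)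

Lemma fib_polySS (R : nzRingType) n :
  fib_poly R n.+2 = 'X * fib_poly R n.+1 + fib_poly R n.
Proof. by []. Qed.

Lemma size_fib_poly (R : nzRingType) n : (size (fib_poly R n) <= n)%N.
Proof.
elim/ltn_ind: n => -[|[|n]] IHn; rewrite ?size_poly0 ?size_poly1 //.
rewrite fib_polySS (leq_trans (size_polyD _ _)) // geq_max.
rewrite -commr_polyX (leq_trans (size_mul_leq _ _)) ?size_polyX.
  by rewrite (leq_trans (IHn n _)) // leqW.
by rewrite addn2 ltnS IHn.
Qed.

Lemma coef_fib_poly_last (R : nzRingType) n : (fib_poly R n.+1)`_n = 1.
Proof.
elim: n => [|n IHn]; first by rewrite coef1.
rewrite fib_polySS coefD coefXM IHn nth_default ?addr0 //.
exact: leq_trans (size_fib_poly R n) (leqnSn n).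
Qed.

(** * Sequences obeying the Fibonacci recurrence at a fixed x *)

Section FibRecurrence.

Variables (R : comNzRingType) (x : R).

Definition fib_rec (u : nat -> R) := forall n, u n.+2 = x * u n.+1 + u n.

(* The value at [n - c] of the extension of [f] to negative indices, for odd [c];
   there [f_(-j) = (-1)^(j+1) f_j]. *)
Definition shifted_fib c n : R :=
  if (n <= c)%N then (-1) ^+ n * (fib_poly R (c - n)).[x]
  else (fib_poly R (n - c)).[x].

(** Oddness of [c] matters at the junction [n.+1 = c]: there [n] is even, so f_(-1) = f_1. *)
Lemma fib_rec_shifted_fib c : odd c -> fib_rec (shifted_fib c).
Proof.
move=> c_odd n; rewrite /shifted_fib.
case: (ltngtP n.+1 c) => [lt_nc|gt_nc|eq_nc].
- have -> : (n <= c)%N by lia.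
  have -> : (c - n = (c - n.+2).+2)%N by lia.
  have -> : (c - n.+1 = (c - n.+2).+1)%N by lia.
  rewrite fib_polySS hornerD hornerM hornerX !exprS; ring.
- have [->|ne_nc] := eqVneq n c.
    rewrite leqnn subnn subSnn subSn // subSnn /= !hornerE; ring.
  have -> : (n <= c)%N = false by lia.
  have -> : (n.+2 - c = (n - c).+2)%N by lia.
  have -> : (n.+1 - c = (n - c).+1)%N by lia.
  by rewrite fib_polySS !hornerE.
- have n_even : odd n = false by move: c_odd; rewrite -eq_nc /=; case: odd.
  rewrite -eq_nc leqnSn !subSnn subnn -[_ ^+ n]signr_odd n_even.
  by rewrite /= hornerC horner0 !mulr0 add0r mul1r.
Qed.

Lemma fib_rec_shift u k : fib_rec u -> fib_rec (fun n => u (n + k)%N).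
Proof. by move=> u_rec n; rewrite !addSn u_rec. Qed.

(* [seq_form u N] is the linear form sending ['X^i] to [u i] for [i < N]. *)
Definition seq_form (u : nat -> R) (N : nat) (P : {poly R}) : R :=
  \sum_(i < N) P`_i * u i.

Lemma seq_formD u N P Q :
  seq_form u N (P + Q) = seq_form u N P + seq_form u N Q.
Proof. by rewrite -big_split; apply: eq_bigr => i _; rewrite coefD mulrDl. Qed.

Lemma seq_formZ u N a P : seq_form u N (a *: P) = a * seq_form u N P.
Proof. by rewrite mulr_sumr; apply: eq_bigr => i _; rewrite coefZ mulrA. Qed.

Lemma seq_formN u N P : seq_form u N (- P) = - seq_form u N P.
Proof. by rewrite -scaleN1r seq_formZ mulN1r. Qed.

Lemma seq_formXn u N k : (k < N)%N -> seq_form u N 'X^k = u k.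
Proof.
move=> ltkN; rewrite /seq_form (bigD1 (Ordinal ltkN)) //= coefXn eqxx mul1r.
rewrite big1 ?addr0 // => i; rewrite -val_eqE /= => /negPf ne_ik.
by rewrite coefXn ne_ik mul0r.
Qed.

(** By linearity take P = X^i: the form then yields u_(i+2) - x u_(i+1) - u_i. *)
Lemma seq_form_char_poly u N (P : {poly R}) : fib_rec u -> (size P + 2 <= N)%N ->
  seq_form u N (('X^2 - x *: 'X - 1) * P) = 0.
Proof.
move=> u_rec szP; rewrite -[P]coefK poly_def mulr_sumr.
elim/big_rec: _ => [|i Q _ IHQ].
  by rewrite -(scale0r 0) seq_formZ mul0r.
rewrite seq_formD IHQ addr0 -scalerAr seq_formZ.
have -> : ('X^2 - x *: 'X - 1 : {poly R}) * 'X^i =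
  'X^(i.+2) - x *: 'X^(i.+1) - 'X^i.
  by rewrite -!mul_polyC !exprS; ring.
have lt_iP := ltn_ord i.
rewrite !(seq_formD, seq_formN, seq_formZ, seq_formXn) ?u_rec; try lia.
ring.
Qed.

End FibRecurrence.

(** * Power sums over F_q and a recurrence free of x *)

Section FiniteField.

Variable F : finFieldType.
Local Notation q := #|F|.

Lemma pnat_card_finField : [char F].-nat q.
Proof.
have [p _ pcharFp] := finPcharP F.
rewrite (eq_pnat _ (pcharf_eq pcharFp)) -cardsT.
by have /abelem_pgroup := fin_lmod_pchar_abelem F^o pcharFp.
Qed.

Lemma natr_card_finField : q%:R = 0 :> F.
Proof. by rewrite -FinRing.zmodXgE -cardsT expg_cardG ?inE. Qed.

Lemma sum_expr_finField k :
  (k < q)%N -> \sum_(x : F) x ^+ k = - (k == q.-1)%:R.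
Proof.
have q_gt1 : (1 < q)%N := card_finNzRing_gt1 F.
case: k => [_|k lt_kq].
  rewrite (eq_bigr (fun=> 1)) // sumr_const natr_card_finField.
  by rewrite ltn_eqF ?oppr0 //; lia.
have [k_eq|k_neq] := eqVneq k.+1 q.-1.
  rewrite (bigD1 0) //= expr0n add0r.
  rewrite (eq_bigr (fun=> 1)) => [|x nz_x].
    rewrite sumr_const cardC1 -subn1 natrB ?natr_card_finField ?sub0r //.
    by rewrite ltnW.
  by apply: (mulfI nz_x); rewrite k_eq -exprS prednK ?expf_card ?mulr1 // ltnW.
(* X^(k+1) - 1 has too few roots to vanish at all nonzero c. Replacing x by c x then multiplies the
   sum by a factor other than 1 without changing it. *)
have [c nz_c ck_neq1] : exists2 c : F, c != 0 & c ^+ k.+1 != 1.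
  apply/exists_inP; apply: contraT; rewrite negb_exists_in => /forall_inP ck1.
  have roots : all k.+1.-unity_root (enum (predC1 (0 : F))).
    apply/allP => c; rewrite mem_enum => /ck1; rewrite negbK => /eqP.
    by move/unity_rootP.
  have := max_unity_roots (isT : (0 < k.+1)%N) roots (enum_uniq _).
  rewrite -cardE (cardC1 0 : _ = q.-1) leqNgt ltn_neqAle k_neq.
  by rewrite -ltnS prednK ?lt_kq // ltnW.
have nz_ck1 : c ^+ k.+1 - 1 != 0 by rewrite subr_eq0.
rewrite oppr0; apply: (mulfI nz_ck1); rewrite mulr0 mulrBl mul1r mulr_sumr.
apply/eqP; rewrite subr_eq0; apply/eqP.
rewrite [RHS](reindex_inj (mulfI nz_c)).
by apply: eq_bigr => x _; rewrite exprMn.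
Qed.

Lemma sum_horner_finField (P : {poly F}) :
  (size P <= q)%N -> \sum_x P.[x] = - P`_q.-1.
Proof.
have q_gt0 : (0 < q)%N := ltnW (card_finNzRing_gt1 F).
move=> szP; under eq_bigr do rewrite (horner_coef_wide _ szP).
rewrite exchange_big /=; under eq_bigr => i _ do
  rewrite -mulr_sumr sum_expr_finField //.
have lt_q : (q.-1 < q)%N by rewrite prednK.
rewrite (bigD1 (Ordinal lt_q)) //= eqxx mulrN1 big1 ?addr0 // => i.
by rewrite -val_eqE /= => /negPf ->; rewrite oppr0 mulr0.
Qed.

(** Since x has dropped out, this recurrence survives summation over x. *)
Lemma fib_rec_card (x : F) (u : nat -> F) n : fib_rec x u ->
  u (n + q.*2)%N + u (n + q.-1)%N = u (n + q.+1)%N + u n.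
Proof.
have q_gt0 : (0 < q)%N := ltnW (card_finNzRing_gt1 F).
move=> /(@fib_rec_shift _ _ _ n) u_rec.
set m : {poly F} := 'X^2 - x *: 'X - 1.
(* The cofactor of m: in m^q - X^(q-1) m the two terms x X^q cancel. *)
pose P := m ^+ q.-1 - 'X^(q.-1).
have mP : m * P = 'X^(q.*2) - 'X^(q.+1) + 'X^(q.-1) - 1.
  have pnat_q : [char {poly F}].-nat q.
    by rewrite (eq_pnat _ (pchar_poly F)) pnat_card_finField.
  have mq : m ^+ q = 'X^(q.*2) - x *: 'X^q - 1.
    rewrite /m !exprDn_pchar // !exprNn_pchar // exprZn expf_card expr1n.
    by rewrite -exprM mul2n.
  rewrite mulrBr -exprS prednK // mq /m.
  have -> : 'X^(q.+1) = 'X^2 * 'X^(q.-1) :> {poly F}.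
    by rewrite -exprD; congr ('X^_); lia.
  have -> : 'X^q = 'X * 'X^(q.-1) :> {poly F} by rewrite -exprS prednK.
  by rewrite -!mul_polyC; ring.
have := @seq_form_char_poly _ x _ (maxn (size P + 2) q.*2.+1) P u_rec (leq_maxl _ _).
rewrite -/m mP -(expr0 'X) !(seq_formD, seq_formN, seq_formXn); try lia.
rewrite !(addnC _ n) addn0 => E0.
apply/eqP; rewrite -subr_eq0 -E0; apply/eqP; ring.
Qed.

End FiniteField.

(** * From the factored recurrence to a period *)

Section Periodicity.

Variables (R : comNzRingType) (U : nat -> R) (a b : nat).
Hypothesis U_rec : forall n, U (n + (b + a))%N + U (n + a)%N = U (n + b)%N + U n.

(** By [U_rec], the difference U (n + a) - U n changes sign under each shift by b. *)
Lemma alternating_periodic k n :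
  U (n + b * k + a)%N - (-1) ^+ k * U (n + a)%N
    = U (n + b * k)%N - (-1) ^+ k * U n.
Proof.
elim: k => [|k IHk]; first by rewrite muln0 addn0 expr0 !mul1r !subrr.
rewrite (_ : n + b * k.+1 = n + b * k + b)%N; last lia.
have Un2 : U (n + b * k + b + a)%N
    = U (n + b * k + b)%N + U (n + b * k)%N - U (n + b * k + a)%N.
  by rewrite -U_rec addnA addrK.
have Un1 : U (n + b * k + a)%N
    = U (n + b * k)%N - (-1) ^+ k * U n + (-1) ^+ k * U (n + a)%N.
  by rewrite -IHk subrK.
rewrite Un2 Un1 exprS; ring.
Qed.

(* As [h] is odd, [E^b + 1] divides [E^(b h) + 1], where [E] is the shift;
   then [E^a - 1], which divides [E^(a d) - 1 = E^(b h) - 1], does the rest. *)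
Lemma sum_periodic d h n : (a * d = b * h)%N -> odd h ->
  U (n + (b * h).*2)%N = U n.
Proof.
move=> ad_bh h_odd.
pose V m := U (m + b * h)%N + U m.
have V_periodic m k : V (m + a * k)%N = V m.
  elim: k => [|k IHk]; first by rewrite muln0 addn0.
  rewrite mulnS [(a + _)%N]addnC addnA -{}IHk /V.
  have := alternating_periodic h (m + a * k).
  by rewrite -signr_odd h_odd !mulN1r !opprK addnAC.
have := V_periodic n d; rewrite ad_bh /V -addnA addnn addrC.
by move/addrI.
Qed.

End Periodicity.

(** * The coefficients b_k *)

Section BCoef.

Variables (F : finFieldType) (q : nat).
Hypothesis cardF : #|F| = q.

(** As X - X^q = X (1 - X^(q-1)), the extra factor completes a q-th power, which Frobenius expands
    to X^(q-1) - X^(q^2-1). *)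
Lemma b_poly_geometric :
  b_poly F q * (1 - 'X^(q.-1)) = 'X * (1 - 'X^(q ^ 2 - 1)).
Proof.
have q_gt1 : (1 < q)%N by rewrite -cardF card_finNzRing_gt1.
have pnat_q : [char {poly F}].-nat q.
  by rewrite (eq_pnat _ (pchar_poly F)) -cardF pnat_card_finField.
rewrite /b_poly -mulrA subn1; congr (_ * _).
have -> : 'X - 'X^q = 'X * (1 - 'X^(q.-1)) :> {poly F}.
  by rewrite mulrBr mulr1 -exprS prednK // ltnW.
rewrite exprMn mulrDl mul1r -mulrA -exprSr prednK; last exact: ltnW.
rewrite exprDn_pchar // exprNn_pchar // expr1n mulrBr mulr1 -exprM -exprD.
rewrite (_ : (q.-1 + q.-1 * q = q ^ 2 - 1)%N); last first.
  by case: q q_gt1 => [|k] // _; nia.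
by rewrite addrA subrK.
Qed.

Lemma b_coef_eq k : (k < q ^ 2)%N ->
  b_coef F q k = (k == 1)%:R + (if (k < q.-1)%N then 0 else b_coef F q (k - q.-1)).
Proof.
move=> lt_k; have := congr1 (fun P : {poly F} => P`_k) b_poly_geometric.
rewrite /= !mulrBr !mulr1 !coefB coefX coefMXn -exprS coefXn.
rewrite [k == _.+1](_ : _ = false) ?subr0; last first.
  lia.
by move/eqP; rewrite subr_eq => /eqP.
Qed.

Lemma b_coef_arith i : (i <= q)%N -> b_coef F q (1 + i * q.-1)%N = 1.
Proof.
have q_gt1 : (1 < q)%N by rewrite -cardF card_finNzRing_gt1.
elim: i => [_|i IHi lt_iq]; rewrite b_coef_eq; try nia.
  rewrite mul0n addn0 eqxx; case: ltnP => _; first by rewrite addr0.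
  (* The truncated index is 0, and [b_poly] has no constant term. *)
  rewrite (_ : 1 - q.-1 = 0)%N; last by lia.
  by rewrite [b_coef _ _ _]coefXM addr0.
have -> : (1 + i.+1 * q.-1 == 1)%N = false by nia.
rewrite mulSn addnCA addKn [(_ < q.-1)%N]ltnNge leq_addr /=.
by rewrite IHi ?add0r // ltnW.
Qed.

End BCoef.

(** * The sums S_j, including negative j *)

Section FibSum.

Variables (F : finFieldType) (q : nat).
Hypothesis cardF : #|F| = q.

Let q_gt1 : (1 < q)%N. Proof. by rewrite -cardF card_finNzRing_gt1. Qed.

Definition fib_sum j : F := \sum_(x : F) (fib_poly F j).[x].

Lemma fib_sum_small j : (j < q)%N -> fib_sum j = 0.
Proof.
move=> lt_jq; have szj := size_fib_poly F j.
rewrite /fib_sum sum_horner_finField cardF; last exact: leq_trans szj (ltnW _).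
by rewrite nth_default ?oppr0 // (leq_trans szj) // -ltnS prednK //; lia.
Qed.

Lemma fib_sum_card : fib_sum q = -1.
Proof.
rewrite /fib_sum sum_horner_finField ?cardF ?size_fib_poly //.
have -> : fib_poly F q = fib_poly F q.-1.+1 by rewrite prednK //; lia.
by rewrite coef_fib_poly_last.
Qed.

(** [U n] is S_(n - q); the offset q just reaches the nonzero value S_(-q). *)
Definition shifted_fib_sum n : F := \sum_(x : F) shifted_fib x q n.
Local Notation U := shifted_fib_sum.

Lemma shifted_fib_sumE j : U (j + q)%N = fib_sum j.
Proof.
apply: eq_bigr => x _; rewrite /shifted_fib addnK.
have [le_jq|//] := leqP (j + q)%N q.
have -> : j = 0%N by lia.
by rewrite subnn /= !horner0 mulr0.
Qed.

Lemma shifted_fib_sum0 : U 0%N = -1.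
Proof.
rewrite -fib_sum_card; apply: eq_bigr => x _.
by rewrite /shifted_fib /= mul1r subn0.
Qed.

Lemma shifted_fib_sum_small n : (0 < n < q.*2)%N -> U n = 0.
Proof.
move=> n_lt; have [le_nq|lt_qn] := leqP n q.
  rewrite -(mulr0 ((-1) ^+ n)) -(@fib_sum_small (q - n)); last by lia.
  by rewrite mulr_sumr; apply: eq_bigr => x _; rewrite /shifted_fib le_nq.
by rewrite -(subnK (ltnW lt_qn)) shifted_fib_sumE fib_sum_small //; lia.
Qed.

Hypothesis q_odd : odd q.

Let q_ge3 : (3 <= q)%N. Proof. by move: q_odd q_gt1; lia. Qed.

Lemma shifted_fib_sum_rec n :
  U (n + (q.+1 + q.-1))%N + U (n + q.-1)%N = U (n + q.+1)%N + U n.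
Proof.
rewrite (_ : q.+1 + q.-1 = q.*2)%N; last by lia.
rewrite -!big_split; apply: eq_bigr => x _.
by rewrite -cardF; apply/fib_rec_card/fib_rec_shifted_fib; rewrite cardF.
Qed.

(** With q = 2h + 1, the residue mod 4 makes h odd, and (q^2 - 1) / 2 = (q + 1) h = (q - 1) (h + 1)
    is a multiple of both shifts. *)
Lemma shifted_fib_sum_period n :
  q = 3 %[mod 4] -> U (n + (q ^ 2 - 1))%N = U n.
Proof.
move=> q_mod4.
have [h q_half] : exists h, q = h.*2.+1.
  by exists q./2; rewrite -[LHS]odd_double_half q_odd.
have h_odd : odd h by move: q_mod4; lia.
have -> : (q ^ 2 - 1 = (q.+1 * h).*2)%N.
  by rewrite q_half; nia.
apply: (sum_periodic shifted_fib_sum_rec (d := h.+1)) => //.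
by rewrite q_half; nia.
Qed.

(** Both sides repeat with step q - 1, and for 0 < k < q they vanish except at k = 1, where S_(-q) =
    -1. *)
Lemma shifted_fib_sum_b_coef k : (0 < k <= q ^ 2 - q + 1)%N ->
  U (k + q)%N + U k.-1 = - b_coef F q k.
Proof.
elim/ltn_ind: k => k IHk k_bound.
rewrite (b_coef_eq cardF); last by nia.
have [lt_kq|ge_kq] := ltnP k q.-1.
  rewrite addr0; have [->|k_neq1] := eqVneq k 1%N.
    by rewrite shifted_fib_sum0 shifted_fib_sum_small ?add0r //; lia.
  by rewrite !shifted_fib_sum_small ?addr0 ?oppr0 //; lia.
(* Here k - (q - 1) = 0 falls outside the induction hypothesis. *)
have [->|k_neq] := eqVneq k q.-1.
  rewrite subnn [b_coef _ _ 0]coefXM addr0 gtn_eqF ?oppr0; last by lia.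
  by rewrite !shifted_fib_sum_small ?addr0 //; lia.
have -> : (k == 1) = false by lia.
rewrite add0r -IHk; try lia.
have := shifted_fib_sum_rec (k - q.-1).-1.
rewrite (_ : (k - q.-1).-1 + (q.+1 + q.-1) = k + q)%N; last by lia.
rewrite (_ : (k - q.-1).-1 + q.-1 = k.-1)%N; last by lia.
by rewrite (_ : (k - q.-1).-1 + q.+1 = k - q.-1 + q)%N; last by lia.
Qed.

(* At [j = q] the index [j - q.+1] truncates to [0], where [fib_sum] vanishes. *)
Lemma fib_sum_b_coef j : (q <= j <= q ^ 2)%N ->
  fib_sum j = - b_coef F q (j - (q - 1))%N - fib_sum (j - q.+1)%N.
Proof.
move=> j_bound; rewrite -shifted_fib_sum_b_coef; last by lia.
have [->|j_neq] := eqVneq j q.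
  rewrite subKn ?subnS ?subnn; last by lia.
  rewrite fib_sum_card shifted_fib_sum0 shifted_fib_sumE.
  by rewrite !fib_sum_small ?add0r ?subr0 //; lia.
have := shifted_fib_sum_rec (j - q).
rewrite -!shifted_fib_sumE.
rewrite (_ : (j - q) + (q.+1 + q.-1) = j + q)%N; last by lia.
rewrite (_ : (j - q) + q.-1 = j.-1)%N; last by lia.
rewrite (_ : (j - q) + q.+1 = (j - (q - 1)) + q)%N; last by lia.
rewrite (_ : (j - q.+1) + q = j.-1)%N; last by lia.
rewrite (_ : (j - (q - 1)).-1 = j - q)%N; last by lia.
by move<-; rewrite addrK.
Qed.

(** The period q^2 - 1 carries S_(q^2-1-i) to S_(-i). *)
Lemma fib_sum_reflect i : q = 3 %[mod 4] -> (i <= q)%N ->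
  fib_sum (q ^ 2 - 1 - i)%N = U (q - i)%N.
Proof.
move=> q_mod4 i_le; rewrite -shifted_fib_sumE -[RHS]shifted_fib_sum_period //.
have le_q2 : (q <= q ^ 2 - 1)%N by nia.
by rewrite (_ : q ^ 2 - 1 - i + q = q - i + (q ^ 2 - 1))%N; last by lia.
Qed.

End FibSum.

(** * The identities, range by range in j *)

Theorem theorem5p2 (p e q : nat) (F : finFieldType)
    (p_prime : prime p) (p_mod4 : p = 3 %[mod 4])
    (e_odd : odd e) (qE : q = (p ^ e)%N) (cardF : #|F| = q) :
  (q = 3%N ->
    [/\ forall j : nat, (1 <= j <= q - 1)%N ->
          \sum_(x : F) (fib_poly F j).[x] = 0,
        forall j : nat, (q <= j <= q + 1)%N ->
          \sum_(x : F) (fib_poly F j).[x] = - b_coef F q (j - (q - 1))%N,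
        forall j : nat, j = (q ^ 2 - (q + 1))%N ->
          \sum_(x : F) (fib_poly F j).[x] = - b_coef F q (j + 2)%N
      & forall j : nat, (q ^ 2 - q <= j <= q ^ 2 - 1)%N ->
          \sum_(x : F) (fib_poly F j).[x] = 0])
  /\
  ((3 < q)%N ->
    [/\ forall j : nat, (1 <= j <= q - 1)%N ->
          \sum_(x : F) (fib_poly F j).[x] = 0,
        forall j : nat, (q <= j <= q + 1)%N ->
          \sum_(x : F) (fib_poly F j).[x] = - b_coef F q (j - (q - 1))%N,
        forall j : nat, (q + 2 <= j <= q ^ 2 - (q + 2))%N ->
          \sum_(x : F) (fib_poly F j).[x] =
            - b_coef F q (j - (q - 1))%N
            - \sum_(x : F) (fib_poly F (j - (q + 1))%N).[x],
        forall j : nat, j = (q ^ 2 - (q + 1))%N ->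
          \sum_(x : F) (fib_poly F j).[x] = - b_coef F q (j + 2)%N
      & forall j : nat, (q ^ 2 - q <= j <= q ^ 2 - 1)%N ->
          \sum_(x : F) (fib_poly F j).[x] = 0]).
Proof.
have q_mod4 : q = 3 %[mod 4].
  (* Since 3^2 = 1 mod 4, an odd power of p stays 3 mod 4. *)
  rewrite qE -[e]odd_double_half e_odd -modnXm p_mod4 -mul2n expnD expnM.
  by rewrite -modnMmr -modnXm exp1n.
have q_ge3 : (3 <= q)%N by move: q_mod4; lia.
have q_odd : odd q by move: q_mod4; lia.
have sum_small j : (1 <= j <= q - 1)%N ->
    \sum_(x : F) (fib_poly F j).[x] = 0.
  by move=> j_bound; apply: (fib_sum_small cardF); lia.
have sum_mid j : (q <= j <= q + 1)%N ->
    \sum_(x : F) (fib_poly F j).[x] = - b_coef F q (j - (q - 1))%N.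
  move=> j_bound; rewrite [LHS](fib_sum_b_coef cardF q_odd); last by nia.
  (* For both values of j the index j - (q + 1) is 0, by truncation when j = q. *)
  by rewrite (fib_sum_small cardF (j := (j - q.+1)%N)) ?subr0 //; lia.
have sum_rec j : (q + 2 <= j <= q ^ 2 - (q + 2))%N ->
    \sum_(x : F) (fib_poly F j).[x] = - b_coef F q (j - (q - 1))%N
      - \sum_(x : F) (fib_poly F (j - (q + 1))%N).[x].
  by move=> j_bound; rewrite addn1; apply: fib_sum_b_coef => //; lia.
have sum_last j : j = (q ^ 2 - (q + 1))%N ->
    \sum_(x : F) (fib_poly F j).[x] = - b_coef F q (j + 2)%N.
  (* Reflection at i = q gives S_(-q) = -1, while j + 2 = 1 + q (q - 1) is the last exponent of the
     geometric sum, with coefficient 1. *)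
  move=> ->; rewrite (_ : q ^ 2 - (q + 1) = q ^ 2 - 1 - q)%N; last by lia.
  rewrite [LHS](fib_sum_reflect cardF q_odd q_mod4) // subnn.
  rewrite (shifted_fib_sum0 cardF).
  rewrite (_ : q ^ 2 - 1 - q + 2 = 1 + q * q.-1)%N; last by nia.
  by rewrite (b_coef_arith cardF).
have sum_top j : (q ^ 2 - q <= j <= q ^ 2 - 1)%N ->
    \sum_(x : F) (fib_poly F j).[x] = 0.
  (* Reflection lands in S_(1-q), ..., S_0, all zero. *)
  move=> j_bound; rewrite (_ : j = q ^ 2 - 1 - (q ^ 2 - 1 - j))%N; last by lia.
  rewrite [LHS](fib_sum_reflect cardF q_odd q_mod4) //; last by nia.
  by rewrite (shifted_fib_sum_small cardF) //; nia.
by split.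
Qed.
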